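(* The function $x\mapsto \dfrac{1}{[\Gamma(x+1)]^{1/x}}$ is logarithmically completely monotonic on $(-1,\infty)$.
   Context: A positive function $f$ on an interval $I$ is called logarithmically completely monotonic on $I$ if it has derivatives of all orders on $I$ and $(-1)^n[\ln f(x)]^{(n)}\ge 0$ for all $x\in I$ and all $n\in\mathbb{N}=\{1,2,\dots\}$. $\Gamma$ is the Euler gamma function. Convention: at $x=0$ the expression $[\Gamma(x+1)]^{1/x}$ is assigned its limiting value $e^{-\gamma}$, where $\gamma$ is the Euler–Mascheroni constant. *)

(* Defs.v *)
From Stdlib Require Import Reals.
From Coquelicot Require Import Coquelicot.
Open Scope R_scope.

(* Euler's integral, improper at both ends; it is meaningful for [0 < s]
   (where the integral converges) and junk elsewhere. *)
Definition Gamma (s : R) : R :=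
  RInt_gen (fun t => Rpower t (s - 1) * exp (- t))
    (at_right 0) (Rbar_locally p_infty).

(* The Euler-Mascheroni constant; the [n = 0] term is irrelevant. *)
Definition euler_gamma : R :=
  real (Lim_seq (fun n => sum_n_m (fun k => / INR k) 1 n - ln (INR n))).

(* Restricted to open intervals [(a, b)], possibly unbounded, so that the
   two-sided derivatives at a point of the interval only depend on the
   function there. *)
Definition log_completely_monotonic (a b : Rbar) (f : R -> R) : Prop :=
  (forall x : R, Rbar_lt a x -> Rbar_lt x b -> 0 < f x) /\
  (forall (n : nat) (x : R), Rbar_lt a x -> Rbar_lt x b -> ex_derive_n f n x) /\
  (forall (n : nat) (x : R), (1 <= n)%nat -> Rbar_lt a x -> Rbar_lt x b ->
     0 <= (-1) ^ n * Derive_n (fun y => ln (f y)) n x).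

(* [Gamma(x+1)]^(1/x), with its limiting value at [x = 0]; [Rpower] is the
   usual real power here because [Gamma (x + 1) > 0] for [-1 < x]. *)
Definition gamma_root (x : R) : R :=
  if Req_EM_T x 0 then exp (- euler_gamma) else Rpower (Gamma (x + 1)) (1 / x).

(* Main.v *)
Require Import Defs.
From Stdlib Require Import Reals Factorial Lra Lia.
From Coquelicot Require Import Coquelicot.
Open Scope R_scope.

(* Euler's integral satisfies [Gamma (s + 1) = s Gamma s] and
   [Gamma (a + s) <= a^s Gamma a] for [0 <= s <= 1]. As in the Bohr-Mollerup
   theorem, these two facts imply that [ln Gamma (x + 1)] is the limit of
   [x ln N + ln N! - sum_(k <= N) ln (x + k)] for [x > -1]. The derivatives of
   order at least [2] of these approximations are locally bounded uniformly in
   [N], so all derivatives converge, to functions [L_n], and [L_n] is the [n]-th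
   derivative of [ln Gamma (x + 1)]; for [n >= 2] it has the sign [(-1)^n].
   Finally [- ln Gamma (x + 1) / x] is [- int_0^1 L_1 (x u) du], which is also
   correct at [x = 0] since [L_1 0 = - euler_gamma], and differentiating [n]
   times under the integral sign gives [- int_0^1 u^n L_(n+1) (x u) du]. *)

(** * Repeated differentiability *)

(** The derivative is an existential witness constrained only on [D], so that closure under sums,
    products and [exp] follows by induction on the order, without Leibniz or Faa di Bruno
    formulas. *)
Fixpoint differentiable_n (D : R -> Prop) (n : nat) (f : R -> R) : Prop :=
  match n with
  | O => True
  | S m => exists f1 : R -> R,
      (forall x, D x -> is_derive f x (f1 x)) /\ differentiable_n D m f1
  end.

Lemma differentiable_n_S (D : R -> Prop) (n : nat) (f : R -> R) :
  differentiable_n D (S n) f -> differentiable_n D n f.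
Proof.
revert f; induction n as [|n IH]; intros f H.
- exact I.
- destruct H as [f1 [Hf1 H1]]; exists f1; split; [exact Hf1|].
  now apply IH.
Qed.

Lemma differentiable_n_plus (D : R -> Prop) (n : nat) (f g : R -> R) :
  differentiable_n D n f -> differentiable_n D n g ->
  differentiable_n D n (fun x => f x + g x).
Proof.
revert f g; induction n as [|n IH]; intros f g Hf Hg.
- exact I.
- destruct Hf as [f1 [Hf1 Hf2]], Hg as [g1 [Hg1 Hg2]].
  exists (fun x => f1 x + g1 x); split; [|now apply IH].
  intros x Dx; apply @is_derive_plus; auto.
Qed.

Lemma differentiable_n_mult (D : R -> Prop) (n : nat) (f g : R -> R) :
  differentiable_n D n f -> differentiable_n D n g ->
  differentiable_n D n (fun x => f x * g x).
Proof.
revert f g; induction n as [|n IH]; intros f g Hf Hg.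
- exact I.
- pose proof (differentiable_n_S _ _ _ Hf) as Hf'.
  pose proof (differentiable_n_S _ _ _ Hg) as Hg'.
  destruct Hf as [f1 [Hf1 Hf2]], Hg as [g1 [Hg1 Hg2]].
  exists (fun x => f1 x * g x + f x * g1 x); split.
  + intros x Dx; apply @is_derive_mult; auto; intros; apply Rmult_comm.
  + apply differentiable_n_plus; now apply IH.
Qed.

(** The derivative [f1 x * exp (f x)] contains the function itself, whose differentiability at the
    lower order is the induction hypothesis; the product lemma concludes. *)
Lemma differentiable_n_exp (D : R -> Prop) (n : nat) (f : R -> R) :
  differentiable_n D n f -> differentiable_n D n (fun x => exp (f x)).
Proof.
induction n as [|n IH]; intros Hf.
- exact I.
- pose proof (differentiable_n_S _ _ _ Hf) as Hf'.
  destruct Hf as [f1 [Hf1 Hf2]].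
  exists (fun x => f1 x * exp (f x)); split.
  + intros x Dx; apply (is_derive_comp exp f); [apply is_derive_exp|auto].
  + apply differentiable_n_mult; auto.
Qed.

Lemma differentiable_n_family (D : R -> Prop) (f : nat -> R -> R) :
  (forall n x, D x -> is_derive (f n) x (f (S n) x)) ->
  forall n m, differentiable_n D n (f m).
Proof.
intros Hf n; induction n as [|n IH]; intros m; [exact I|].
exists (f (S m)); auto.
Qed.

Lemma differentiable_n_ex_derive_n (D : R -> Prop) (n : nat) (f : R -> R) :
  open D -> differentiable_n D n f -> forall x, D x -> ex_derive_n f n x.
Proof.
intros HD; revert f; induction n as [|n IH]; intros f Hf x Dx; [exact I|].
destruct Hf as [f1 [Hf1 Hf2]].
(* Openness of [D] turns agreement of [f1] with the total function [Derive f] on [D] into agreement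
   near [x], which is what iterated derivatives see. *)
assert (Hloc : locally x (fun y => f1 y = Derive f y)).
{ apply filter_imp with D; [|now apply HD].
  intros y Dy; symmetry; apply is_derive_unique, Hf1, Dy. }
pose proof (ex_derive_n_ext_loc _ _ n x Hloc (IH _ Hf2 x Dx)) as H.
destruct n as [|n].
- exists (f1 x); now apply Hf1.
- simpl in H |- *.
  apply ex_derive_ext with (2 := H).
  intros t; change (Derive f) with (Derive_n f 1).
  now rewrite Derive_n_comp, Nat.add_1_r.
Qed.

Lemma Derive_n_family (D : R -> Prop) (f : nat -> R -> R) :
  open D -> (forall n x, D x -> is_derive (f n) x (f (S n) x)) ->
  forall n x, D x -> Derive_n (f O) n x = f n x.
Proof.
intros HD Hf n; induction n as [|n IH]; intros x Dx; [reflexivity|].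
simpl; rewrite (Derive_ext_loc _ (f n)).
- now apply is_derive_unique, Hf.
- apply filter_imp with D; [apply IH|now apply HD].
Qed.

(** * Differentiating a pointwise limit *)

(** The mean value theorem is used twice: f(y) - f(x) = f1(c) (y - x), then f1(c) - f1(x) = f2(e) (c
    - x), with |c - x| <= |y - x|. *)
Lemma derivative_remainder_le (f f1 f2 : R -> R) (x d M : R) :
  (forall y, Rabs (y - x) < d ->
     is_derive f y (f1 y) /\ is_derive f1 y (f2 y) /\ Rabs (f2 y) <= M) ->
  forall y, Rabs (y - x) < d ->
    Rabs (f y - f x - (y - x) * f1 x) <= M * (y - x) ^ 2.
Proof.
intros H y Hy.
assert (Hb : forall c, Rmin x y <= c <= Rmax x y -> Rabs (c - x) <= Rabs (y - x)).
{ intros c; unfold Rmin, Rmax, Rabs.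
  intros Hc; destruct (Rle_dec x y); destruct (Rcase_abs (c - x));
  destruct (Rcase_abs (y - x)); intros; lra. }
destruct (MVT_gen f x y f1) as [c [Hc Ec]].
{ intros z Hz; apply H; apply Rle_lt_trans with (2 := Hy), Hb; split; apply Rlt_le, Hz. }
{ intros z Hz; apply derivable_continuous_pt; exists (f1 z); apply is_derive_Reals, H.
  now apply Rle_lt_trans with (2 := Hy), Hb. }
pose proof (Hb c Hc) as Hcx.
assert (Hb' : forall z, Rmin x c <= z <= Rmax x c -> Rabs (z - x) < d).
{ intros z Hz; apply Rle_lt_trans with (2 := Hy), Hb.
  revert Hz Hc; unfold Rmin, Rmax.
  destruct (Rle_dec x y); destruct (Rle_dec x c); lra. }
destruct (MVT_gen f1 x c f2) as [e [He Ee]].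
{ intros z Hz; apply H, Hb'; split; apply Rlt_le, Hz. }
{ intros z Hz; apply derivable_continuous_pt; exists (f2 z).
  now apply is_derive_Reals, H, Hb'. }
replace (f y - f x - (y - x) * f1 x) with (f2 e * ((c - x) * (y - x))).
2: { rewrite Ec; replace (f1 c) with (f1 x + f2 e * (c - x)) by lra; ring. }
rewrite Rabs_mult.
apply Rmult_le_compat; try apply Rabs_pos.
- now apply H, Hb'.
- rewrite Rabs_mult, <- Rsqr_pow2, (Rsqr_abs (y - x)); unfold Rsqr.
  apply Rmult_le_compat_r; [apply Rabs_pos|exact Hcx].
Qed.

(* The difference quotients with step [h] converge, and they differ from the
   derivatives by [O(h)] uniformly in [N]. *)
Lemma derivatives_converge (F F1 F2 : nat -> R -> R) (x d M : R) :
  0 < d ->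
  (forall N y, Rabs (y - x) < d ->
     is_derive (F N) y (F1 N y) /\ is_derive (F1 N) y (F2 N y) /\
     Rabs (F2 N y) <= M) ->
  (forall y, Rabs (y - x) < d -> ex_finite_lim_seq (fun N => F N y)) ->
  ex_finite_lim_seq (fun N => F1 N x).
Proof.
intros Hd H HF.
assert (HM : 0 <= M).
{ apply Rle_trans with (Rabs (F2 O x)); [apply Rabs_pos|].
  apply (H O x). rewrite Rminus_eq_0, Rabs_R0; exact Hd. }
apply ex_lim_seq_cauchy_corr; intros eps.
pose proof (cond_pos eps) as Heps.
(* The step stays inside the neighbourhood and makes [M * h] at most [eps / 4]. Two such errors plus
   [eps / 2] for the Cauchy difference quotients give [eps]. The denominator uses [M + 1] because
   [M] may be 0. *)
set (h := Rmin (d / 2) (eps / (4 * (M + 1)))).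
assert (Hh : 0 < h).
{ apply Rmin_case; [lra|apply Rdiv_lt_0_compat; lra]. }
assert (Hhd : Rabs (x + h - x) < d).
{ replace (x + h - x) with h by ring; rewrite Rabs_right by lra.
  apply Rle_lt_trans with (d / 2); [apply Rmin_l|lra]. }
assert (HMh : M * h <= eps / 4).
{ apply Rle_trans with ((M + 1) * h); [nra|].
  apply Rle_trans with ((M + 1) * (eps / (4 * (M + 1)))).
  - apply Rmult_le_compat_l; [lra|apply Rmin_r].
  - apply Req_le; field; lra. }
assert (Hq : forall N, Rabs ((F N (x + h) - F N x) / h - F1 N x) <= M * h).
{ intros N.
  pose proof (derivative_remainder_le (F N) (F1 N) (F2 N) x d M (H N) _ Hhd) as T.
  replace ((F N (x + h) - F N x) / h - F1 N x)
    with ((F N (x + h) - F N x - (x + h - x) * F1 N x) / h) by (field; lra).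
  unfold Rdiv; rewrite Rabs_mult, (Rabs_right (/ h)).
  2: { apply Rle_ge, Rlt_le, Rinv_0_lt_compat, Hh. }
  apply Rmult_le_reg_r with h; [exact Hh|].
  rewrite Rmult_assoc, Rinv_l by lra.
  replace (M * h * h) with (M * (x + h - x) ^ 2) by ring; lra. }
assert (Hc : ex_finite_lim_seq (fun N => (F N (x + h) - F N x) / h)).
{ destruct (HF _ Hhd) as [l1 L1].
  destruct (HF x) as [l0 L0]; [rewrite Rminus_eq_0, Rabs_R0; exact Hd|].
  exists ((l1 - l0) * / h).
  apply (is_lim_seq_scal_r _ (/ h) (Finite (l1 - l0))).
  now apply is_lim_seq_minus'. }
apply ex_lim_seq_cauchy_corr in Hc.
destruct (Hc (pos_div_2 eps)) as [N0 HN0]; exists N0; intros n m Hn Hm.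
specialize (HN0 n m Hn Hm); simpl in HN0.
pose proof (Hq n) as Qn; pose proof (Hq m) as Qm.
apply Rabs_le_between in Qn; apply Rabs_le_between in Qm.
apply Rabs_lt_between in HN0; apply Rabs_lt_between; lra.
Qed.

(** Since [M] does not depend on [N], the quadratic remainder bound survives the limit in [N], and
    dividing it by the increment gives differentiability of [l]. *)
Lemma is_derive_limit (F F1 F2 : nat -> R -> R) (l l1 : R -> R) (x d M : R) :
  0 < d ->
  (forall N y, Rabs (y - x) < d ->
     is_derive (F N) y (F1 N y) /\ is_derive (F1 N) y (F2 N y) /\
     Rabs (F2 N y) <= M) ->
  (forall y, Rabs (y - x) < d -> is_lim_seq (fun N => F N y) (l y)) ->
  is_lim_seq (fun N => F1 N x) (l1 x) ->
  is_derive l x (l1 x).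
Proof.
intros Hd H HF HF1.
assert (Hx : Rabs (x - x) < d) by (rewrite Rminus_eq_0, Rabs_R0; exact Hd).
assert (HM : 0 <= M).
{ apply Rle_trans with (Rabs (F2 O x)); [apply Rabs_pos|]; now apply (H O x). }
assert (T : forall y, Rabs (y - x) < d ->
  Rabs (l y - l x - (y - x) * l1 x) <= M * (y - x) ^ 2).
{ intros y Hy.
  apply (is_lim_seq_le (fun N => Rabs (F N y - F N x - (y - x) * F1 N x))
    (fun _ => M * (y - x) ^ 2) (Rabs (l y - l x - (y - x) * l1 x))
    (M * (y - x) ^ 2)).
  - intros N; apply (derivative_remainder_le _ _ (F2 N) x d M (H N) y Hy).
  - apply (is_lim_seq_abs _ (Finite _)), is_lim_seq_minus'.
    + apply is_lim_seq_minus'; auto.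
    + now apply (is_lim_seq_scal_l _ (y - x) (Finite (l1 x))).
  - apply is_lim_seq_const. }
apply is_derive_Reals; intros eps Heps.
assert (Hdel : 0 < Rmin d (eps / (M + 1))).
{ apply Rmin_case; [exact Hd|apply Rdiv_lt_0_compat; lra]. }
exists (mkposreal _ Hdel); intros h Hh0 Hh; simpl in Hh.
assert (Hhx : Rabs (x + h - x) < d).
{ replace (x + h - x) with h by ring.
  apply Rlt_le_trans with (1 := Hh), Rmin_l. }
specialize (T _ Hhx); replace (x + h - x) with h in T by ring.
pose proof (Rabs_pos_lt _ Hh0) as Hp.
replace ((l (x + h) - l x) / h - l1 x) with ((l (x + h) - l x - h * l1 x) / h)
  by (field; exact Hh0).
rewrite Rabs_div by exact Hh0.
apply Rle_lt_trans with (M * Rabs h).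
- apply Rmult_le_reg_r with (Rabs h); [exact Hp|].
  unfold Rdiv; rewrite Rmult_assoc, Rinv_l by lra.
  rewrite Rmult_assoc; change (Rabs h * Rabs h) with (Rsqr (Rabs h)).
  rewrite <- Rsqr_abs, Rsqr_pow2; lra.
- apply Rle_lt_trans with (M * (eps / (M + 1))).
  + apply Rmult_le_compat_l; [exact HM|].
    apply Rlt_le, Rlt_le_trans with (1 := Hh), Rmin_r.
  + apply Rmult_lt_reg_r with (M + 1); [lra|].
    replace (M * (eps / (M + 1)) * (M + 1)) with (M * eps) by (field; lra); nra.
Qed.

(* Only pointwise convergence of the functions themselves is assumed: by
   Taylor's formula the bounds propagate it to all derivatives. *)
Lemma limit_family (D : R -> Prop) (F : nat -> nat -> R -> R) (l : R -> R) :
  open D ->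
  (forall N n x, D x -> is_derive (F N n) x (F N (S n) x)) ->
  (forall n x, D x -> exists M, locally x (fun y => forall N, Rabs (F N (S (S n)) y) <= M)) ->
  (forall x, D x -> is_lim_seq (fun N => F N O x) (l x)) ->
  exists L : nat -> R -> R,
    L O = l /\
    (forall n x, D x -> is_lim_seq (fun N => F N n x) (L n x)) /\
    (forall n x, D x -> is_derive (L n) x (L (S n) x)).
Proof.
intros HD HF HB Hl.
assert (Hloc : forall n x, D x -> exists d M, 0 < d /\
  forall y, Rabs (y - x) < d -> D y /\ forall N,
     is_derive (F N n) y (F N (S n) y) /\ is_derive (F N (S n)) y (F N (S (S n)) y) /\
     Rabs (F N (S (S n)) y) <= M).
{ intros n x Dx; destruct (HB n x Dx) as [M HM].
  destruct (filter_and _ _ HM (HD x Dx)) as [d Hd].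
  exists d, M; split; [apply cond_pos|]; intros y Hy.
  destruct (Hd y Hy) as [H1 H2]; auto 6. }
assert (Hconv : forall n x, D x -> ex_finite_lim_seq (fun N => F N n x)).
{ induction n as [|n IH]; intros x Dx.
  - exists (l x); auto.
  - destruct (Hloc n x Dx) as [d [M [Hd H]]].
    apply (derivatives_converge (fun N => F N n) (fun N => F N (S n))
      (fun N => F N (S (S n))) x d M Hd).
    + intros N y Hy; now apply H.
    + intros y Hy; now apply IH, H. }
(* Order 0 is [l] itself rather than a [Lim_seq]: the two are known to agree only on [D], whereas
   [L O = l] is an equality of functions. *)
set (L := fun n x => match n with O => l x | S _ => real (Lim_seq (fun N => F N n x)) end).
assert (HL : forall n x, D x -> is_lim_seq (fun N => F N n x) (L n x)).
{ intros [|n] x Dx; [now apply Hl|].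
  unfold L; now apply Lim_seq_correct', Hconv. }
exists L; split; [reflexivity|split; [exact HL|]].
intros n x Dx; destruct (Hloc n x Dx) as [d [M [Hd H]]].
apply (is_derive_limit (fun N => F N n) (fun N => F N (S n))
  (fun N => F N (S (S n))) (L n) (L (S n)) x d M Hd); auto.
- intros N y Hy; now apply H.
- intros y Hy; now apply HL, H.
Qed.

(** * Euler's integral *)

Lemma filter_prod_right_infty (P : R -> R -> Prop) (a b : R) :
  0 < a ->
  (forall x y, 0 < x < a -> b < y -> P x y) ->
  filter_prod (at_right 0) (Rbar_locally p_infty) (fun ab => P (fst ab) (snd ab)).
Proof.
intros Ha H.
apply Filter_prod with (fun x => 0 < x < a) (fun y => b < y).
- exists (mkposreal a Ha); intros y Hy Hy0; split; [exact Hy0|].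
  unfold ball in Hy; simpl in Hy; unfold AbsRing_ball, abs, minus, plus, opp in Hy.
  simpl in Hy; apply Rabs_lt_between in Hy; lra.
- exists b; auto.
- exact H.
Qed.

(* The integrals over [[x, y]] increase as [x] decreases and [y] increases. *)
Lemma ex_RInt_gen_bounded (f : R -> R) (B : R) :
  (forall t, 0 < t -> 0 <= f t) ->
  (forall x y, 0 < x -> x <= y -> ex_RInt f x y) ->
  (forall x y, 0 < x -> x <= y -> RInt f x y <= B) ->
  exists l, is_RInt_gen f (at_right 0) (Rbar_locally p_infty) l /\
    forall x y, 0 < x -> x <= y -> RInt f x y <= l.
Proof.
intros Hf Hex HB.
set (E := fun r => exists x y, 0 < x /\ x <= y /\ r = RInt f x y).
destruct (completeness E) as [l [Hub Hleast]].
{ exists B; intros r (x & y & Hx & Hxy & ->); auto. }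
{ exists (RInt f 1 1), 1, 1; repeat split; lra. }
exists l; split.
2: { intros x y Hx Hxy; apply Hub; now exists x, y. }
intros P [eps HP].
(* Some segment [[a, b]] has integral within [eps] of the supremum; by monotonicity every larger
   segment does too. *)
assert (He : exists r, E r /\ l - eps < r).
{ apply Classical_Prop.NNPP; intros Hn.
  assert (l <= l - eps).
  { apply Hleast; intros r Er; apply Rnot_lt_le; intros Hr; apply Hn; now exists r. }
  pose proof (cond_pos eps); lra. }
destruct He as (r & (a & b & Ha & Hab & ->) & Hr).
apply (filter_prod_right_infty
  (fun x y => exists z, is_RInt f x y z /\ P z) a b Ha).
intros x y Hx Hy; exists (RInt f x y); split.
{ apply (@RInt_correct R_CompleteNormedModule), Hex; lra. }
apply HP.
assert (RInt f a b <= RInt f x y).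
{ rewrite <- (RInt_Chasles f x a y) by (apply Hex; lra).
  rewrite <- (RInt_Chasles f a b y) by (apply Hex; lra).
  assert (0 <= RInt f x a) by (apply RInt_ge_0; [lra|apply Hex; lra|intros; apply Hf; lra]).
  assert (0 <= RInt f b y) by (apply RInt_ge_0; [lra|apply Hex; lra|intros; apply Hf; lra]).
  unfold plus; simpl; lra. }
assert (RInt f x y <= l) by (apply Hub; exists x, y; repeat split; lra).
unfold ball; simpl; unfold AbsRing_ball, abs, minus, plus, opp; simpl.
pose proof (cond_pos eps); apply Rabs_lt_between; lra.
Qed.

Lemma is_RInt_gen_0_infty_unique (f : R -> R) (l : R) :
  is_RInt_gen f (at_right 0) (Rbar_locally p_infty) l ->
  RInt_gen f (at_right 0) (Rbar_locally p_infty) = l.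
Proof. apply (is_RInt_gen_unique (V := R_CompleteNormedModule)). Qed.

Definition gamma_integrand (s t : R) : R := Rpower t (s - 1) * exp (- t).

Lemma continuous_gamma_integrand (s t : R) :
  0 < t -> continuous (gamma_integrand s) t.
Proof.
intros Ht; apply (@ex_derive_continuous R_AbsRing R_NormedModule); unfold gamma_integrand, Rpower.
auto_derive; exact Ht.
Qed.

Lemma ex_RInt_gamma_integrand (s x y : R) :
  0 < x -> x <= y -> ex_RInt (gamma_integrand s) x y.
Proof.
intros Hx Hxy; apply (@ex_RInt_continuous R_CompleteNormedModule); intros z Hz.
apply continuous_gamma_integrand; rewrite Rmin_left in Hz by exact Hxy; lra.
Qed.

Lemma gamma_integrand_pos (s t : R) : 0 < gamma_integrand s t.
Proof. apply Rmult_lt_0_compat; apply exp_pos. Qed.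

(** This is ln q <= q at q = t / (2 s), multiplied by [s] and exponentiated. Only half of the decay
    of exp(-t) is spent on absorbing the power. *)
Lemma Rpower_le_exp_half (s t : R) :
  0 < s -> 0 < t -> Rpower t s <= Rpower (2 * s) s * exp (t / 2).
Proof.
intros Hs Ht; unfold Rpower; rewrite <- exp_plus.
assert (H : s * ln t <= s * ln (2 * s) + t / 2).
2: { destruct H as [H|H]; [left; now apply exp_increasing|right; now f_equal]. }
assert (Hq : 0 < t / (2 * s)) by (apply Rdiv_lt_0_compat; lra).
assert (Hl : ln (t / (2 * s)) <= t / (2 * s)).
{ pose proof (exp_ineq1_le (ln (t / (2 * s)))) as E; rewrite exp_ln in E by exact Hq; lra. }
rewrite ln_div in Hl by lra.
apply (Rmult_le_compat_l s) in Hl; [|lra].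
replace (s * (t / (2 * s))) with (t / 2) in Hl by (field; lra); lra.
Qed.

(* [- C / (1 + t^s)] is bounded, and its derivative
   [C s t^(s-1) / (1 + t^s)^2] dominates the integrand for a large [C]. *)
Lemma RInt_gamma_integrand_bounded (s : R) :
  0 < s -> exists B, forall x y, 0 < x -> x <= y ->
    RInt (gamma_integrand s) x y <= B.
Proof.
intros Hs.
(* From 1 + t^s <= (1 + (2 s)^s) e^(t/2), squaring gives e^(-t) (1 + t^s)^2 <= (1 + (2 s)^s)^2 = C
   s, which is the required domination. *)
set (C := (1 + Rpower (2 * s) s) ^ 2 / s).
set (U := fun t => - C / (1 + Rpower t s)).
set (dU := fun t => C * (s * Rpower t (s - 1)) / (1 + Rpower t s) ^ 2).
assert (Pp : forall t p, 0 < Rpower t p) by (intros; apply exp_pos).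
assert (HC : 0 < C).
{ apply Rdiv_lt_0_compat; [|exact Hs]. apply pow_lt; pose proof (Pp (2 * s) s); lra. }
assert (HU : forall t, 0 < t -> is_derive U t (dU t)).
{ intros t Ht.
  assert (E : is_derive (fun t => Rpower t s) t (s * Rpower t (s - 1)))
    by (apply is_derive_Reals, derivable_pt_lim_power, Ht).
  unfold U, dU; pose proof (Pp t s).
  evar_last.
  - apply is_derive_div; [apply is_derive_const| |lra].
    apply (@is_derive_plus R_AbsRing R_NormedModule); [apply is_derive_const|exact E].
  - unfold zero, plus; simpl; field; lra. }
assert (HdU : forall t, 0 < t -> continuous dU t).
{ intros t Ht; apply (@ex_derive_continuous R_AbsRing R_NormedModule); unfold dU, Rpower.
  auto_derive; repeat split; try exact Ht.
  pose proof (Pp t s); unfold Rpower in *; apply Rgt_not_eq; nra. }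
exists C; intros x y Hx Hxy.
assert (HI : is_RInt dU x y (minus (U y) (U x))).
{ apply (@is_RInt_derive R_CompleteNormedModule); intros t Ht; rewrite Rmin_left in Ht by exact Hxy;
  [apply HU|apply HdU]; lra. }
apply Rle_trans with (RInt dU x y).
- apply RInt_le; [exact Hxy|now apply ex_RInt_gamma_integrand|now exists (minus (U y) (U x))|].
  intros t Ht; unfold gamma_integrand, dU.
  pose proof (Pp t s) as P1; pose proof (Pp t (s - 1)) as P2.
  pose proof (Rpower_le_exp_half s t Hs ltac:(lra)) as P3.
  pose proof (Pp (2 * s) s) as P4.
  assert (P5 : 1 <= exp (t / 2)) by (pose proof (exp_ineq1_le (t / 2)); lra).
  assert (P6 : exp (- t) * (exp (t / 2)) ^ 2 = 1).
  { simpl; rewrite Rmult_1_r, <- !exp_plus; replace (- t + (t / 2 + t / 2)) with 0 by field.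
    apply exp_0. }
  replace (C * (s * Rpower t (s - 1)) / (1 + Rpower t s) ^ 2)
    with (Rpower t (s - 1) * ((1 + Rpower (2 * s) s) ^ 2 / (1 + Rpower t s) ^ 2))
    by (unfold C; field; split; lra).
  apply Rmult_le_compat_l; [lra|].
  apply Rmult_le_reg_r with ((1 + Rpower t s) ^ 2); [apply pow_lt; lra|].
  unfold Rdiv; rewrite Rmult_assoc, Rinv_l by (apply pow_nonzero; lra).
  rewrite Rmult_1_r.
  apply Rle_trans with (exp (- t) * ((1 + Rpower (2 * s) s) * exp (t / 2)) ^ 2).
  + apply Rmult_le_compat_l; [left; apply exp_pos|].
    apply pow_incr; split; [lra|]; nra.
  + rewrite Rpow_mult_distr.
    replace (exp (- t) * ((1 + Rpower (2 * s) s) ^ 2 * exp (t / 2) ^ 2))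
      with ((1 + Rpower (2 * s) s) ^ 2 * (exp (- t) * exp (t / 2) ^ 2)) by ring.
    rewrite P6; lra.
- rewrite (is_RInt_unique _ _ _ _ HI); unfold minus, plus, opp, U; simpl.
  pose proof (Pp x s) as P1; pose proof (Pp y s) as P2.
  assert (0 < C / (1 + Rpower y s)) by (apply Rdiv_lt_0_compat; lra).
  assert (C / (1 + Rpower x s) <= C).
  { apply Rmult_le_reg_r with (1 + Rpower x s); [lra|].
    unfold Rdiv; rewrite Rmult_assoc, Rinv_l by lra; nra. }
  unfold Rdiv in *; lra.
Qed.

Lemma is_RInt_gen_Gamma (s : R) :
  0 < s ->
  is_RInt_gen (gamma_integrand s) (at_right 0) (Rbar_locally p_infty) (Gamma s)
  /\ 0 < Gamma s.
Proof.
intros Hs; destruct (RInt_gamma_integrand_bounded s Hs) as [B HB].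
destruct (ex_RInt_gen_bounded (gamma_integrand s) B) as [l [Hl Hle]].
- intros; left; apply gamma_integrand_pos.
- apply ex_RInt_gamma_integrand.
- exact HB.
- assert (E : Gamma s = l) by exact (is_RInt_gen_0_infty_unique _ _ Hl).
  rewrite E; split; [exact Hl|].
  (* Positivity comes from any one segment, as [l] bounds all the partial integrals from above. *)
  apply Rlt_le_trans with (RInt (gamma_integrand s) 1 2); [|apply Hle; lra].
  apply RInt_gt_0; [lra|intros; apply gamma_integrand_pos|].
  intros; apply continuous_gamma_integrand; lra.
Qed.

(** The fundamental theorem of calculus with limits at both improper ends, from hypotheses on the
    open half-line only; endpoints in (0, 1) and above 1 keep the whole segment there. *)
Lemma is_RInt_gen_gamma_derive (f df : R -> R) (la lb : R) :
  (forall t, 0 < t -> is_derive f t (df t)) ->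
  (forall t, 0 < t -> continuous df t) ->
  filterlim f (at_right 0) (locally la) ->
  filterlim f (Rbar_locally p_infty) (locally lb) ->
  is_RInt_gen df (at_right 0) (Rbar_locally p_infty) (lb - la).
Proof.
intros Hf Hc Ha Hb.
assert (Hpos : forall x y z : R, 0 < x < 1 -> 1 < y -> Rmin x y <= z -> 0 < z).
{ intros x y z Hx Hy; rewrite Rmin_left by lra; lra. }
apply (@is_RInt_gen_ext R_NormedModule (at_right 0) (Rbar_locally p_infty) _ _ (Derive f)).
- apply (filter_prod_right_infty
    (fun a b => forall x, Rmin a b < x < Rmax a b -> Derive f x = df x) 1 1 Rlt_0_1).
  intros a b Ha' Hb' x Hx; apply is_derive_unique, Hf.
  apply (Hpos a b x Ha' Hb'); lra.
- apply is_RInt_gen_Derive; try assumption.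
  + apply (filter_prod_right_infty
      (fun a b => forall x, Rmin a b <= x <= Rmax a b -> ex_derive f x) 1 1 Rlt_0_1).
    intros a b Ha' Hb' x Hx; exists (df x); apply Hf.
    apply (Hpos a b x Ha' Hb'); lra.
  + apply (filter_prod_right_infty
      (fun a b => forall x, Rmin a b <= x <= Rmax a b -> continuous (Derive f) x) 1 1 Rlt_0_1).
    intros a b Ha' Hb' x Hx.
    assert (Hx0 : 0 < x) by (apply (Hpos a b x Ha' Hb'); lra).
    apply continuous_ext_loc with df; [|now apply Hc].
    apply filter_imp with (fun y => 0 < y); [|now apply open_gt].
    intros y Hy; symmetry; now apply is_derive_unique, Hf.
Qed.

Lemma filterlim_exp_opp_infty :
  filterlim (fun t => exp (- t)) (Rbar_locally p_infty) (locally 0).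
Proof.
apply (is_lim_comp exp Ropp p_infty 0 m_infty).
- apply is_lim_exp_m.
- apply (is_lim_opp (fun y => y) p_infty p_infty), is_lim_id.
- exists 0; discriminate.
Qed.

Lemma Gamma_1 : Gamma 1 = 1.
Proof.
replace 1 with (0 - (- 1)) at 2 by ring.
apply (is_RInt_gen_0_infty_unique (gamma_integrand 1)).
apply (is_RInt_gen_gamma_derive (fun t => - exp (- t))).
- intros t Ht; unfold gamma_integrand; replace (1 - 1) with 0 by ring; rewrite Rpower_O by exact Ht.
  auto_derive; [exact I|ring].
- intros t Ht; apply continuous_gamma_integrand, Ht.
- apply (filterlim_filter_le_1 _ (filter_le_within _)).
  replace (-1) with (- exp (- 0)) by (rewrite Ropp_0, exp_0; ring).
  apply (@ex_derive_continuous R_AbsRing R_NormedModule (fun t => - exp (- t))).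
  auto_derive; exact I.
- replace 0 with (- 0) by ring.
  apply (is_lim_opp (fun t => exp (- t)) p_infty 0), filterlim_exp_opp_infty.
Qed.

(** Integration by parts: t^s e^(-t) vanishes at both ends, and its derivative is s times the
    integrand at [s] minus the integrand at [s + 1]. *)
Lemma Gamma_plus_1 (s : R) : 0 < s -> Gamma (s + 1) = s * Gamma s.
Proof.
intros Hs.
destruct (is_RInt_gen_Gamma s Hs) as [G0 _].
destruct (is_RInt_gen_Gamma (s + 1) ltac:(lra)) as [G1 _].
assert (H : is_RInt_gen
  (fun t => minus (scal s (gamma_integrand s t)) (gamma_integrand (s + 1) t))
  (at_right 0) (Rbar_locally p_infty) (0 - 0)).
{ apply (is_RInt_gen_gamma_derive (fun t => Rpower t s * exp (- t))).
  - intros t Ht.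
    evar_last.
    + apply (is_derive_mult (fun t => Rpower t s) (fun t => exp (- t)) t).
      * apply is_derive_Reals, derivable_pt_lim_power, Ht.
      * instantiate (1 := - exp (- t)); auto_derive; [exact I|ring].
      * intros; apply Rmult_comm.
    + unfold gamma_integrand, minus, scal, plus, opp, mult; simpl; unfold mult; simpl.
      replace (s + 1 - 1) with s by ring; ring.
  - intros t Ht; apply (@continuous_minus _ R_AbsRing R_NormedModule).
    + apply (@continuous_scal_r _ R_AbsRing R_NormedModule), continuous_gamma_integrand, Ht.
    + apply continuous_gamma_integrand, Ht.
  (* At the origin, t^s e^(-t) <= t^s, which is below [eps] once t < eps^(1/s). *)
  - intros P [eps HP].
    assert (Hd : 0 < Rpower eps (/ s)) by apply exp_pos.
    exists (mkposreal _ Hd); intros t Bt Ht; apply HP.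
    unfold ball in *; simpl in *; unfold AbsRing_ball, abs, minus, plus, opp in *; simpl in *.
    rewrite Ropp_0, Rplus_0_r in *.
    rewrite Rabs_right in Bt by lra.
    assert (0 < Rpower t s) by apply exp_pos.
    assert (0 < exp (- t)) by apply exp_pos.
    rewrite Rabs_right by nra.
    assert (exp (- t) <= 1) by (left; rewrite <- exp_0; apply exp_increasing; lra).
    apply Rle_lt_trans with (Rpower t s); [nra|].
    replace (pos eps) with (Rpower (Rpower eps (/ s)) s).
    + apply Rlt_Rpower_l; lra.
    + rewrite Rpower_mult, Rinv_l by lra; apply Rpower_1, cond_pos.
  (* At infinity, the boundary term is squeezed between 0 and (2 s)^s e^(-t/2). *)
  - apply (is_lim_le_le_loc (fun _ => 0) (fun t => Rpower (2 * s) s * exp (- (t / 2)))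
      _ p_infty 0).
    + exists 0; intros t Ht.
      pose proof (Rpower_le_exp_half s t Hs Ht).
      assert (0 < Rpower t s) by apply exp_pos.
      assert (0 < exp (- t)) by apply exp_pos.
      split; [nra|].
      replace (- (t / 2)) with (t / 2 + - t) by field; rewrite exp_plus.
      rewrite <- Rmult_assoc; apply Rmult_le_compat_r; lra.
    + apply is_lim_const.
    + evar_last.
      * apply (is_lim_scal_l (fun t => exp (- (t / 2))) (Rpower (2 * s) s) p_infty 0).
        apply (is_lim_comp (fun t => exp (- t)) (fun t => t / 2) p_infty 0 p_infty).
        -- apply filterlim_exp_opp_infty.
        -- evar_last; [apply (is_lim_scal_r (fun t => t) (/ 2) p_infty p_infty), is_lim_id|].
           simpl; case Rle_dec; intros; [|lra]; case Rle_lt_or_eq_dec; intros; [reflexivity|lra].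
        -- exists 0; discriminate.
      * simpl; f_equal; ring. }
pose proof (is_RInt_gen_minus _ _ _ _ (is_RInt_gen_scal _ s _ G0) G1) as H'.
assert (E : 0 - 0 = minus (scal s (Gamma s)) (Gamma (s + 1))).
{ rewrite <- (is_RInt_gen_0_infty_unique _ _ H).
  exact (is_RInt_gen_0_infty_unique _ _ H'). }
unfold minus, scal, plus, opp in E; simpl in E; unfold mult in E; simpl in E; lra.
Qed.

(* Young's inequality [(t/a)^s <= 1 - s + s t/a], integrated against the
   density of [Gamma a]. *)
Lemma Gamma_plus_le (a s : R) :
  0 < a -> 0 <= s <= 1 -> Gamma (a + s) <= Rpower a s * Gamma a.
Proof.
intros Ha Hs.
destruct (is_RInt_gen_Gamma a Ha) as [G0 P0].
destruct (is_RInt_gen_Gamma (a + 1) ltac:(lra)) as [G1 _].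
destruct (is_RInt_gen_Gamma (a + s) ltac:(lra)) as [Gs Ps].
pose proof (is_RInt_gen_plus _ _ _ _
  (is_RInt_gen_scal _ (Rpower a s * (1 - s)) _ G0)
  (is_RInt_gen_scal _ (Rpower a s * s / a) _ G1)) as H.
(* The integrals are compared through a norm inequality; positivity of [Gamma (a + s)] removes the
   absolute value. *)
pose proof (fun H1 H2 => RInt_gen_norm _ _ _ _ H1 H2 Gs H) as N.
unfold norm, plus, scal in N; simpl in N; unfold mult, abs in N; simpl in N.
rewrite (Rabs_right (Gamma (a + s))), Gamma_plus_1 in N by lra.
replace (Rpower a s * Gamma a)
  with (Rpower a s * (1 - s) * Gamma a + Rpower a s * s / a * (a * Gamma a))
  by (field; lra).
apply N.
- apply (filter_prod_right_infty (fun x y => x <= y) 1 1); intros; lra.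
- apply (filter_prod_right_infty (fun x y => forall t, x <= t <= y ->
    Rabs (gamma_integrand (a + s) t) <=
    Rpower a s * (1 - s) * gamma_integrand a t +
    Rpower a s * s / a * gamma_integrand (a + 1) t) 1 1); [lra|].
  intros x y Hx Hy t Ht.
  rewrite Rabs_right by (apply Rle_ge, Rlt_le, gamma_integrand_pos).
  unfold gamma_integrand.
  assert (Ht0 : 0 < t) by lra.
  replace (a + s - 1) with ((a - 1) + s) by ring.
  replace (a + 1 - 1) with ((a - 1) + 1) by ring.
  rewrite !Rpower_plus, Rpower_1 by exact Ht0.
  assert (0 < Rpower t (a - 1) * exp (- t))
    by (apply Rmult_lt_0_compat; apply exp_pos).
  assert (K : Rpower t s <= Rpower a s * (1 - s + s * (t / a))).
  { assert (Hta : 0 < t / a) by (apply Rdiv_lt_0_compat; lra).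
    replace (Rpower t s) with (Rpower a s * Rpower (t / a) s).
    2: { rewrite Rpower_mult_distr by assumption.
         f_equal; field; lra. }
    apply Rmult_le_compat_l; [left; apply exp_pos|].
    unfold Rpower; set (u := ln (t / a)).
    assert (Eu : t / a = exp u) by (unfold u; now rewrite exp_ln).
    rewrite Eu.
    (* tangent lines of [exp] at [s u], evaluated at [0] and at [u] *)
    pose proof (exp_ineq1_le (- (s * u))) as E0.
    pose proof (exp_ineq1_le (u - s * u)) as E1.
    pose proof (exp_pos (s * u)) as Ep.
    assert (F0 : exp (s * u) * exp (- (s * u)) = 1)
      by (rewrite <- exp_plus, Rplus_opp_r; apply exp_0).
    assert (F1 : exp (s * u) * exp (u - s * u) = exp u)
      by (rewrite <- exp_plus; f_equal; ring).
    apply (Rmult_le_compat_l (exp (s * u))) in E0; [|lra].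
    apply (Rmult_le_compat_l (exp (s * u))) in E1; [|lra].
    rewrite F0 in E0; rewrite F1 in E1.
    (* With weights 1 - s and s the terms linear in [u] cancel, leaving e^(s u) <= (1 - s) + s
       e^u. *)
    apply (Rmult_le_compat_l (1 - s)) in E0; [|lra].
    apply (Rmult_le_compat_l s) in E1; [|lra].
    nra. }
  apply Rle_trans with (Rpower a s * (1 - s + s * (t / a)) * (Rpower t (a - 1) * exp (- t))).
  + replace (Rpower t (a - 1) * Rpower t s * exp (- t))
      with (Rpower t s * (Rpower t (a - 1) * exp (- t))) by ring.
    apply Rmult_le_compat_r; lra.
  + apply Req_le; field; lra.
Qed.

(** * Gauss's limit formula *)

Lemma sum_n_m_1_S (a : nat -> R) (N : nat) :
  sum_n_m a 1 (S N) = sum_n_m a 1 N + a (S N).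
Proof. apply (sum_n_Sm a 1 N); lia. Qed.

Lemma sum_n_m_1_0 (a : nat -> R) : sum_n_m a 1 0 = 0.
Proof. apply (sum_n_m_zero a 1 0); lia. Qed.

Lemma is_derive_sum_n_m_1 (f : nat -> R -> R) (f1 : nat -> R) (x : R) (N : nat) :
  (forall k, (1 <= k)%nat -> is_derive (f k) x (f1 k)) ->
  is_derive (fun y => sum_n_m (fun k => f k y) 1 N) x (sum_n_m f1 1 N).
Proof.
intros H; induction N as [|N IH].
- rewrite sum_n_m_1_0.
  apply (is_derive_ext (fun _ => 0)); [intros; symmetry; apply sum_n_m_1_0|].
  apply @is_derive_const.
- rewrite sum_n_m_1_S.
  apply (is_derive_ext (fun y => sum_n_m (fun k => f k y) 1 N + f (S N) y)).
  { intros; symmetry; apply sum_n_m_1_S. }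
  apply (@is_derive_plus R_AbsRing R_NormedModule); [exact IH|apply H; lia].
Qed.

Lemma sum_n_m_1_nonneg (a : nat -> R) (N : nat) :
  (forall k, (1 <= k)%nat -> 0 <= a k) -> 0 <= sum_n_m a 1 N.
Proof.
intros H; induction N as [|N IH].
- rewrite sum_n_m_1_0; lra.
- rewrite sum_n_m_1_S; specialize (H (S N) ltac:(lia)); lra.
Qed.

(** Telescoping with 1/(k + 1)^2 <= 1/k - 1/(k + 1) bounds the partial sums of 1/k^2 by 2 - 1/N, a
    form that carries the induction. *)
Lemma sum_n_m_1_inv_sqr_le (a : nat -> R) (C : R) (N : nat) :
  0 <= C -> (forall k, (1 <= k)%nat -> Rabs (a k) <= C * / INR k ^ 2) ->
  Rabs (sum_n_m a 1 N) <= 2 * C.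
Proof.
intros HC H.
assert (G : forall N, Rabs (sum_n_m a 1 (S N)) <= C * (2 - / INR (S N))).
{ induction N0 as [|N0 IH]; rewrite sum_n_m_1_S.
  - rewrite sum_n_m_1_0, Rplus_0_l.
    apply Rle_trans with (1 := H 1%nat (le_n _)); simpl; right; field.
  - apply Rle_trans with (1 := Rabs_triang _ _).
    specialize (H (S (S N0)) ltac:(lia)).
    assert (/ INR (S (S N0)) ^ 2 <= / INR (S N0) - / INR (S (S N0))).
    { rewrite (S_INR (S N0)); pose proof (pos_INR N0); rewrite (S_INR N0).
      set (m := INR N0) in *.
      replace (/ (m + 1) - / (m + 1 + 1)) with (/ ((m + 1) * (m + 1 + 1)))
        by (field; lra).
      apply Rinv_le_contravar; nra. }
    nra. }
destruct N as [|N].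
- rewrite sum_n_m_1_0, Rabs_R0; lra.
- apply Rle_trans with (1 := G N).
  assert (0 < / INR (S N)) by (apply Rinv_0_lt_compat, lt_0_INR; lia).
  nra.
Qed.

(** Closed form of the [n]-th derivative of ln(y + k) with respect to [y]. *)
Definition log_shift (k n : nat) (y : R) : R :=
  match n with
  | O => ln (y + INR k)
  | S m => (-1) ^ m * INR (fact m) * / (y + INR k) ^ (S m)
  end.

Lemma is_derive_log_shift (k n : nat) (y : R) :
  0 < y + INR k -> is_derive (log_shift k n) y (log_shift k (S n) y).
Proof.
intros H; destruct n as [|n]; unfold log_shift.
- auto_derive; [exact H|simpl; field; lra].
- assert (y + INR k <> 0) by lra.
  assert (E : is_derive (fun y => (y + INR k) ^ S n) y (INR (S n) * 1 * (y + INR k) ^ n)).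
  { evar_last; [apply is_derive_pow|reflexivity].
    auto_derive; [exact I|reflexivity]. }
  evar_last.
  + apply (is_derive_scal (fun y => / (y + INR k) ^ S n)), is_derive_inv; [exact E|].
    now apply pow_nonzero.
  + rewrite fact_simpl, mult_INR; simpl pow; field; split; [now apply pow_nonzero|assumption].
Qed.

(* The [n]-th derivatives of the logarithms of Gauss's approximations
   [N^x Gamma(N + 1) / ((x + 1) ... (x + N))] of [Gamma (x + 1)]. *)
Definition log_gauss (N n : nat) (x : R) : R :=
  match n with
  | O => x * ln (INR N) + ln (Gamma (INR N + 1))
  | S O => ln (INR N)
  | _ => 0
  end - sum_n_m (fun k => log_shift k n x) 1 N.

Lemma is_derive_log_gauss (N n : nat) (x : R) :
  -1 < x -> is_derive (log_gauss N n) x (log_gauss N (S n) x).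
Proof.
intros Hx; unfold log_gauss; apply (@is_derive_minus R_AbsRing R_NormedModule).
- destruct n as [|[|n]]; auto_derive; trivial; ring.
- apply is_derive_sum_n_m_1; intros k Hk; apply is_derive_log_shift.
  apply le_INR in Hk; simpl in Hk; lra.
Qed.

(** Near [x], y + k >= d + k - 1 >= d k for k >= 1 since d <= 1. The terms of order n + 2 are thus
    at most (n + 1)! / (d k)^(n + 2) <= C / k^2, and their sums are bounded uniformly in [N]. *)
Lemma log_gauss_bounded (n : nat) (x : R) :
  -1 < x ->
  exists M, locally x (fun y => forall N, Rabs (log_gauss N (S (S n)) y) <= M).
Proof.
intros Hx.
set (d := Rmin 1 ((x + 1) / 2)).
assert (Hd : 0 < d) by (apply Rmin_case; lra).
assert (Hd1 : d <= 1) by apply Rmin_l.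
assert (Hd2 : d <= (x + 1) / 2) by apply Rmin_r.
set (C := INR (fact (S n)) * / d ^ S (S n)).
assert (HC : 0 <= C).
{ apply Rmult_le_pos; [apply pos_INR|left; apply Rinv_0_lt_compat, pow_lt, Hd]. }
exists (2 * C).
apply filter_imp with (fun y => (x + 1) / 2 - 1 < y); [|apply open_gt; lra].
intros y Hy N; unfold log_gauss; rewrite Rminus_0_l, Rabs_Ropp.
apply sum_n_m_1_inv_sqr_le; [exact HC|].
intros k Hk; assert (Hk' : 1 <= INR k) by (apply le_INR in Hk; exact Hk).
unfold log_shift; rewrite !Rabs_mult, pow_1_abs, Rmult_1_l.
rewrite (Rabs_right (INR _)) by (apply Rle_ge, pos_INR).
unfold C; rewrite Rmult_assoc; apply Rmult_le_compat_l; [apply pos_INR|].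
assert (Hdk : d * INR k <= y + INR k) by nra.
assert (Hdk0 : 0 < d * INR k) by nra.
rewrite Rabs_right by (apply Rle_ge, Rlt_le, Rinv_0_lt_compat, pow_lt; lra).
rewrite <- Rinv_mult; apply Rinv_le_contravar.
- apply Rmult_lt_0_compat; apply pow_lt; lra.
- apply Rle_trans with ((d * INR k) ^ S (S n)); [|apply pow_incr; lra].
  rewrite Rpow_mult_distr; apply Rmult_le_compat_l; [left; apply pow_lt, Hd|].
  apply Rle_pow; [exact Hk'|lia].
Qed.

Lemma ln_Gamma_plus_INR (x : R) (N : nat) :
  -1 < x ->
  ln (Gamma (x + 1 + INR N)) =
  ln (Gamma (x + 1)) + sum_n_m (fun k => ln (x + INR k)) 1 N.
Proof.
intros Hx; induction N as [|N IH].
- rewrite sum_n_m_1_0; simpl; now rewrite !Rplus_0_r.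
- rewrite sum_n_m_1_S, <- Rplus_assoc, <- IH, S_INR, <- Rplus_assoc.
  pose proof (pos_INR N).
  rewrite Gamma_plus_1, ln_mult; try lra; [|apply is_RInt_gen_Gamma; lra].
  rewrite Rplus_comm; do 2 f_equal; ring.
Qed.

Lemma is_lim_seq_ln_plus_minus_ln (c : R) :
  0 < c -> is_lim_seq (fun N => ln (INR N + c) - ln (INR N)) 0.
Proof.
intros Hc.
apply (is_lim_seq_ext_loc (fun N => ln (1 + c * / INR N))).
{ exists 1%nat; intros N HN; apply le_INR in HN; simpl in HN.
  rewrite <- ln_div by lra; f_equal; field; lra. }
rewrite <- ln_1; apply (is_lim_seq_continuous ln _ 1).
- apply derivable_continuous_pt; exists (/ 1); apply derivable_pt_lim_ln; lra.
- replace (Finite 1) with (Finite (1 + c * 0)) by (f_equal; ring).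
  apply is_lim_seq_plus'; [apply is_lim_seq_const|].
  apply (is_lim_seq_scal_l _ c 0).
  apply (is_lim_seq_inv _ p_infty); [apply is_lim_seq_INR|discriminate].
Qed.

(** For x > -1 this is ln Gamma(x + 1) minus [log_gauss N 0 x], rewritten with the iterated
    functional equation so that only values of Gamma at large arguments are compared. *)
Definition gauss_error (x : R) (N : nat) : R :=
  ln (Gamma (x + 1 + INR N)) - ln (Gamma (INR N + 1)) - x * ln (INR N).

(** [Gamma_plus_le] squeezes from both sides: from N + 1 to N + 1 + s it gives the upper bound, and
    from N + 1 + s to N + 2, with Gamma(N + 2) = (N + 1) Gamma(N + 1), the lower one. The terms in
    [ln (INR N)] cancel, so the bounds hold at N = 0 as well. *)
Lemma gauss_error_unit (s : R) : 0 <= s <= 1 -> is_lim_seq (gauss_error s) 0.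
Proof.
intros Hs.
apply (is_lim_seq_le_le
  (fun N => (ln (INR N + 1) - ln (INR N)) - (1 - s) * (ln (INR N + (1 + s)) - ln (INR N)))
  _ (fun N => s * (ln (INR N + 1) - ln (INR N)))).
- intros N; unfold gauss_error; pose proof (pos_INR N) as HN.
  assert (P1 : 0 < Gamma (INR N + 1)) by (apply is_RInt_gen_Gamma; lra).
  assert (P2 : 0 < Gamma (s + 1 + INR N)) by (apply is_RInt_gen_Gamma; lra).
  assert (R0 : forall a p, 0 < Rpower a p) by (intros; apply exp_pos).
  pose proof (Gamma_plus_le (INR N + 1) s ltac:(lra) Hs) as U.
  pose proof (Gamma_plus_le (INR N + (1 + s)) (1 - s) ltac:(lra) ltac:(lra)) as V.
  replace (INR N + 1 + s) with (s + 1 + INR N) in U by ring.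
  replace (INR N + (1 + s) + (1 - s)) with (INR N + 1 + 1) in V by ring.
  rewrite Gamma_plus_1 in V by lra.
  replace (Gamma (INR N + (1 + s))) with (Gamma (s + 1 + INR N)) in V by (f_equal; ring).
  apply ln_le in U; [|exact P2].
  apply ln_le in V; [|apply Rmult_lt_0_compat; lra].
  rewrite !ln_mult in V by (try apply R0; lra).
  rewrite ln_mult in U by (try apply R0; lra).
  unfold Rpower in U, V; rewrite ln_exp in U, V.
  split; lra.
- replace (Finite 0) with (Finite (0 - (1 - s) * 0)) by (f_equal; ring).
  apply is_lim_seq_minus'; [apply is_lim_seq_ln_plus_minus_ln; lra|].
  apply (is_lim_seq_scal_l _ (1 - s) 0), is_lim_seq_ln_plus_minus_ln; lra.
- replace (Finite 0) with (Finite (s * 0)) by (f_equal; ring).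
  apply (is_lim_seq_scal_l _ s 0), is_lim_seq_ln_plus_minus_ln; lra.
Qed.

Lemma gauss_error_plus_1 (x : R) (N : nat) :
  -1 < x ->
  gauss_error (x + 1) N = gauss_error x N + (ln (INR N + (x + 1)) - ln (INR N)).
Proof.
intros Hx; unfold gauss_error; pose proof (pos_INR N).
replace (x + 1 + 1 + INR N) with (x + 1 + INR N + 1) by ring.
rewrite Gamma_plus_1, ln_mult; try lra; [|apply is_RInt_gen_Gamma; lra].
rewrite (Rplus_comm (x + 1) (INR N)); ring.
Qed.

(** A unit shift of [x] changes the error by a null sequence. Hence the case of [0, 1] extends
    upwards by induction, and one shift downwards covers (-1, 0). *)
Lemma is_lim_seq_gauss_error (x : R) : -1 < x -> is_lim_seq (gauss_error x) 0.
Proof.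
intros Hx.
assert (G : forall n x, 0 <= x <= INR n + 1 -> is_lim_seq (gauss_error x) 0).
{ induction n as [|n IH]; intros z Hz.
  - apply gauss_error_unit; simpl in Hz; lra.
  - rewrite S_INR in Hz; destruct (Rle_dec z 1) as [Hz1|Hz1].
    + apply gauss_error_unit; lra.
    + apply (is_lim_seq_ext (fun N => gauss_error (z - 1) N +
        (ln (INR N + (z - 1 + 1)) - ln (INR N)))).
      * intros N; rewrite <- gauss_error_plus_1 by lra; f_equal; ring.
      * replace (Finite 0) with (Finite (0 + 0)) by (f_equal; ring).
        apply is_lim_seq_plus'; [apply IH; lra|].
        apply is_lim_seq_ln_plus_minus_ln; lra. }
destruct (Rle_dec 0 x) as [H0|H0].
- destruct (nfloor_ex x H0) as [n Hn]; apply (G n); lra.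
- apply (is_lim_seq_ext (fun N => gauss_error (x + 1) N -
    (ln (INR N + (x + 1)) - ln (INR N)))).
  + intros N; rewrite gauss_error_plus_1 by exact Hx; ring.
  + replace (Finite 0) with (Finite (0 - 0)) by (f_equal; ring).
    apply is_lim_seq_minus'; [apply (G O); simpl; lra|].
    apply is_lim_seq_ln_plus_minus_ln; lra.
Qed.

Lemma is_lim_seq_log_gauss (x : R) :
  -1 < x -> is_lim_seq (fun N => log_gauss N 0 x) (ln (Gamma (x + 1))).
Proof.
intros Hx.
apply (is_lim_seq_ext (fun N => ln (Gamma (x + 1)) - gauss_error x N)).
- intros N; unfold gauss_error, log_gauss, log_shift.
  rewrite ln_Gamma_plus_INR by exact Hx; ring.
- replace (Finite (ln (Gamma (x + 1)))) with (Finite (ln (Gamma (x + 1)) - 0))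
    by (f_equal; ring).
  apply is_lim_seq_minus'; [apply is_lim_seq_const|now apply is_lim_seq_gauss_error].
Qed.

(** * Averages of a function over a segment issued from the origin *)

Lemma segment_gt_m1 (x u : R) : -1 < x -> 0 <= u <= 1 -> -1 < x * u.
Proof. intros; destruct (Rle_dec 0 x); nra. Qed.

Lemma ex_RInt_pow_scaled (g : R -> R) (n : nat) (x : R) :
  (forall y, -1 < y -> continuous g y) -> -1 < x ->
  ex_RInt (fun u => u ^ n * g (x * u)) 0 1.
Proof.
intros Hg Hx; apply (@ex_RInt_continuous R_CompleteNormedModule); intros u Hu.
rewrite Rmin_left, Rmax_right in Hu by lra.
apply (@continuous_mult _ R_AbsRing).
- apply (@ex_derive_continuous R_AbsRing R_NormedModule); auto_derive; exact I.
- apply (continuous_comp (fun u => x * u) g).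
  + apply (@ex_derive_continuous R_AbsRing R_NormedModule); auto_derive; exact I.
  + now apply Hg, segment_gt_m1.
Qed.

(** Differentiation under the integral sign; the chain rule brings out one factor [u], which raises
    the power by one. *)
Lemma is_derive_RInt_pow_scaled (g g1 : R -> R) (n : nat) (x : R) :
  (forall y, -1 < y -> is_derive g y (g1 y)) ->
  (forall y, -1 < y -> continuous g1 y) ->
  -1 < x ->
  is_derive (fun z => RInt (fun u => u ^ n * g (z * u)) 0 1) x
    (RInt (fun u => u ^ S n * g1 (x * u)) 0 1).
Proof.
intros Hg Hg1 Hx.
assert (Hd : forall z u, -1 < z * u ->
  is_derive (fun z => u ^ n * g (z * u)) z (u ^ S n * g1 (z * u))).
{ intros z u Hzu; evar_last.
  - apply (is_derive_scal (fun z => g (z * u))).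
    apply (is_derive_comp g (fun z => z * u)); [now apply Hg|].
    instantiate (1 := u); auto_derive; [exact I|ring].
  - unfold scal; simpl; unfold mult; simpl; ring. }
assert (Hloc : locally x (fun z => -1 < z)) by now apply open_gt.
evar_last.
- apply (is_derive_RInt_param (fun z u => u ^ n * g (z * u))).
  + apply filter_imp with (2 := Hloc); intros z Hz u Hu.
    rewrite Rmin_left, Rmax_right in Hu by lra.
    exists (u ^ S n * g1 (z * u)); now apply Hd, segment_gt_m1.
  + intros t Ht; rewrite Rmin_left, Rmax_right in Ht by lra.
    pose proof (segment_gt_m1 x t Hx Ht) as Hxt.
    pose proof (continuity_2d_pt_mult _ _ x t (continuity_2d_pt_id1 x t)
      (continuity_2d_pt_id2 x t)) as Hm.
    apply (continuity_2d_pt_ext_loc (fun u v => v ^ S n * g1 (u * v))).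
    (* Within this distance of [x * t] the product [u * v] stays above -1, so the partial derivative
       has its closed form near the point. *)
    * assert (He : 0 < x * t + 1) by lra.
      destruct (Hm (mkposreal _ He)) as [d H].
      exists d; intros u v Hu Hv; symmetry; apply is_derive_unique, Hd.
      specialize (H u v Hu Hv); simpl in H; apply Rabs_lt_between in H; lra.
    * apply continuity_2d_pt_mult.
      -- apply (continuity_1d_2d_pt_comp (fun v => v ^ S n) (fun _ v => v)).
         ++ apply derivable_continuous_pt, derivable_pt_pow.
         ++ apply continuity_2d_pt_id2.
      -- apply (continuity_1d_2d_pt_comp g1 (fun u v => u * v)); [|exact Hm].
         now apply continuity_pt_filterlim, Hg1.
  + apply filter_imp with (2 := Hloc); intros z Hz.
    apply ex_RInt_pow_scaled; [|exact Hz].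
    intros y Hy; apply (@ex_derive_continuous R_AbsRing R_NormedModule).
    exists (g1 y); now apply Hg.
- apply RInt_ext; intros u Hu; rewrite Rmin_left, Rmax_right in Hu by lra.
  apply is_derive_unique, Hd, segment_gt_m1; lra.
Qed.

(* [ln Gamma (x + 1)] vanishes at [0], so dividing it by [x] amounts to
   averaging its derivative over [[0, x]]. *)
Lemma gamma_root_inv_exp (L : nat -> R -> R) (x : R) :
  (forall y, -1 < y -> L O y = ln (Gamma (y + 1))) ->
  (forall n y, -1 < y -> is_derive (L n) y (L (S n) y)) ->
  L 1%nat 0 = - euler_gamma ->
  -1 < x ->
  1 / gamma_root x = exp (- RInt (fun u => u ^ 0 * L 1%nat (x * u)) 0 1).
Proof.
intros HL0 HL HL1 Hx; unfold gamma_root, Rdiv; rewrite Rmult_1_l.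
destruct (Req_EM_T x 0) as [->|Hx0].
- rewrite (RInt_ext _ (fun _ => - euler_gamma)).
  + rewrite RInt_const; unfold scal; simpl; unfold mult; simpl.
    rewrite <- exp_Ropp; f_equal; ring.
  + intros u _; rewrite Rmult_0_l, HL1; simpl; ring.
- unfold Rpower; rewrite <- exp_Ropp; f_equal; f_equal.
  symmetry; apply is_RInt_unique; evar_last.
  (* The antiderivative is L_0(x u) / x; its value at u = 0 vanishes because Gamma(1) = 1. *)
  + apply (@is_RInt_derive R_CompleteNormedModule (fun u => / x * L O (x * u))).
    * intros u Hu; rewrite Rmin_left, Rmax_right in Hu by lra.
      evar_last.
      -- apply (is_derive_scal (fun u => L O (x * u))).
         apply (is_derive_comp (L O) (fun u => x * u)).
         ++ now apply HL, segment_gt_m1.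
         ++ instantiate (1 := x); auto_derive; [exact I|ring].
      -- unfold scal; simpl; unfold mult; simpl; field; exact Hx0.
    * intros u Hu; rewrite Rmin_left, Rmax_right in Hu by lra.
      apply (@ex_derive_continuous R_AbsRing R_NormedModule).
      exists (x * L 2%nat (x * u)).
      apply (is_derive_ext (fun u => L 1%nat (x * u))); [intros; simpl; ring|].
      apply (is_derive_comp (L 1%nat) (fun u => x * u)).
      -- now apply HL, segment_gt_m1.
      -- auto_derive; [exact I|ring].
  + rewrite Rmult_0_r, Rmult_1_r, !HL0 by lra.
    rewrite Rplus_0_l, Gamma_1, ln_1.
    unfold minus, plus, opp; simpl; field; exact Hx0.
Qed.

(** * Signs of the logarithmic derivatives *)

Theorem theorem1 :
  log_completely_monotonic (Finite (-1)) p_infty (fun x : R => 1 / gamma_root x).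
Proof.
set (D := fun x : R => -1 < x).
assert (HD : open D) by apply open_gt.
destruct (limit_family D log_gauss (fun x => ln (Gamma (x + 1))) HD
  is_derive_log_gauss log_gauss_bounded is_lim_seq_log_gauss)
  as (L & HL0 & Hlim & HL).
assert (HL1 : L 1%nat 0 = - euler_gamma).
{ assert (E : is_lim_seq (fun N => sum_n_m (fun k => / INR k) 1 N - ln (INR N))
    (- L 1%nat 0)).
  { apply (is_lim_seq_ext (fun N => - log_gauss N 1 0)).
    - intros N; unfold log_gauss, log_shift.
      rewrite (sum_n_m_ext _ (fun k => / INR k)); [ring|].
      intros k; rewrite Rplus_0_l; simpl; rewrite !Rmult_1_r, Rmult_1_l; reflexivity.
    - apply (is_lim_seq_opp _ (Finite (L 1%nat 0))), Hlim; unfold D; lra. }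
  unfold euler_gamma; rewrite (is_lim_seq_unique _ _ E); simpl; ring. }
assert (Hcont : forall n y, D y -> continuous (L n) y).
{ intros n y Dy; apply (@ex_derive_continuous R_AbsRing R_NormedModule).
  exists (L (S n) y); now apply HL. }
(* [H n] will be the [n]-th derivative of the logarithm of the function on [D], across the point 0
   included. *)
set (H := fun n x => - RInt (fun u => u ^ n * L (S n) (x * u)) 0 1).
assert (HH : forall n x, D x -> is_derive (H n) x (H (S n) x)).
{ intros n x Dx; apply (@is_derive_opp R_AbsRing R_NormedModule).
  apply is_derive_RInt_pow_scaled; [apply HL|apply Hcont|exact Dx]. }
assert (Hroot : forall x, D x -> exp (H O x) = 1 / gamma_root x).
{ intros x Dx; symmetry; apply (gamma_root_inv_exp L); trivial.
  intros y _; now rewrite HL0. }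
split; [|split].
- intros x Hx _; rewrite <- Hroot by exact Hx; apply exp_pos.
- intros n x Hx _.
  apply (ex_derive_n_ext_loc (fun x => exp (H O x))).
  + apply filter_imp with D; [exact Hroot|now apply HD].
  + apply (differentiable_n_ex_derive_n D); [exact HD| |exact Hx].
    now apply differentiable_n_exp, differentiable_n_family.
- intros n x Hn Hx _.
  rewrite (Derive_n_ext_loc _ (H O)).
  2: { apply filter_imp with D; [|now apply HD].
       intros y Dy; rewrite <- Hroot by exact Dy; apply ln_exp. }
  rewrite (Derive_n_family D H HD HH n x Hx).
  destruct n as [|n]; [lia|].
  unfold H.
  set (I := fun u => u ^ S n * L (S (S n)) (x * u)).
  assert (HI : ex_RInt I 0 1) by (apply ex_RInt_pow_scaled; [apply Hcont|exact Hx]).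
  assert (HIs : RInt (fun u => (-1) ^ n * I u) 0 1 = (-1) ^ n * RInt I 0 1 :> R)
    by apply (RInt_scal I 0 1 ((-1) ^ n) HI).
  replace ((-1) ^ S n * - RInt I 0 1) with ((-1) ^ n * RInt I 0 1) by (simpl pow; ring).
  rewrite <- HIs.
  apply RInt_ge_0; [lra|now apply (@ex_RInt_scal R_NormedModule)|].
  intros u Hu; unfold I.
  assert (Dxu : -1 < x * u) by (apply segment_gt_m1; [exact Hx|lra]).
  replace ((-1) ^ n * (u ^ S n * L (S (S n)) (x * u)))
    with (u ^ S n * ((-1) ^ n * L (S (S n)) (x * u))) by ring.
  apply Rmult_le_pos; [apply pow_le; lra|].
  (* The sign of [L (S (S n))] is inherited from the approximations: the minus sign in [log_gauss]
     turns (-1)^n into (-1)^(n + 1), which cancels the sign of every [log_shift] term of order n +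
     2. *)
  apply (is_lim_seq_le (fun _ => 0) (fun N => (-1) ^ n * log_gauss N (S (S n)) (x * u))
    0 ((-1) ^ n * L (S (S n)) (x * u))).
  + intros N; unfold log_gauss.
    rewrite Rminus_0_l, <- Ropp_mult_distr_r, Ropp_mult_distr_l.
    replace (- (-1) ^ n) with ((-1) ^ S n) by (simpl; ring).
    rewrite <- (sum_n_m_mult_l (K := R_Ring) ((-1) ^ S n) (fun k => log_shift k (S (S n)) (x * u))).
    apply sum_n_m_1_nonneg; intros k Hk; apply le_INR in Hk; simpl in Hk.
    unfold log_shift, mult; simpl mult.
    rewrite <- !Rmult_assoc, <- Rpow_mult_distr.
    replace (-1 * -1) with 1 by ring; rewrite pow1, Rmult_1_l.
    apply Rmult_le_pos; [apply pos_INR|].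
    left; apply Rinv_0_lt_compat, pow_lt; lra.
  + apply is_lim_seq_const.
  + apply (is_lim_seq_scal_l _ _ (Finite (L (S (S n)) (x * u)))), Hlim, Dxu.
Qed.
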